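(* Let $V$ be a quantum vertex algebra over $\mathbb C[[h]]$ with center $\mathfrak z(V)$ and translation operator $D$. The product $$w\cdot u=w_{-1}u,\qquad w,u\in\mathfrak z(V),$$ defines the structure of a unital associative algebra on $\mathfrak z(V)$. Moreover, this algebra is equipped with a derivation defined as the restriction of the translation operator $D$ to $\mathfrak z(V)$.
   Context: Conventions. $V=V_0[[h]]$ ($V_0$ a complex vector space) is a topologically free $\mathbb C[[h]]$-module; tensor products are $h$-adically completed. $V_h((z))$ is the space of series $\sum_{r\in\mathbb Z}v_rz^{-r-1}\in V[[z^{\pm1}]]$ with $v_r\to0$ $h$-adically as $r\to\infty$. For $\ell<0$, $(z\pm w)^{\ell}$ is expanded into a Taylor series in the variable on the right ($w$). A quantum vertex algebra over $\mathbb C[[h]]$ is such a $V$ with the following data. (a) A $\mathbb C[[h]]$-module map $Y(z):V\otimes V\to V_h((z))$; write $Y(v,z)w=Y(z)(v\otimes w)=\sum_{r\in\mathbb Z}(v_rw)z^{-r-1}$, where $v_rw$ is the $r$-product. Weak associativity: for any $u,v,w\in V$, $n\geqslant0$ there is $\ell\geqslant0$ with $(z_0+z_2)^\ell Y(v,z_0+z_2)Y(w,z_2)u-(z_0+z_2)^\ell Y(Y(v,z_0)w,z_2)u\in h^nV[[z_0^{\pm1},z_2^{\pm1}]]$. (b) A vector $\mathbf 1\in V$ (vacuum vector) such that $Y(\mathbf 1,z)v=v$ for all $v$, and $Y(v,z)\mathbf 1$ is a Taylor series in $z$ with value $v$ at $z=0$. (c) A $\mathbb C[[h]]$-module map $D:V\to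 V$ (translation operator) with $D\mathbf 1=0$ and $\frac{d}{dz}Y(v,z)=[D,Y(v,z)]$ for all $v$. (d) A $\mathbb C[[h]]$-module map $\mathcal S=\mathcal S(z):V\otimes V\to V\otimes V\otimes\mathbb C((z))$ with $[D\otimes1,\mathcal S(z)]=-\frac{d}{dz}\mathcal S(z)$; $\mathcal S_{12}(z_1)\mathcal S_{13}(z_1+z_2)\mathcal S_{23}(z_2)=\mathcal S_{23}(z_2)\mathcal S_{13}(z_1+z_2)\mathcal S_{12}(z_1)$; $\mathcal S_{21}(z)=\mathcal S^{-1}(-z)$; and $\mathcal S$-locality: for any $v,w\in V$, $n\geqslant0$ there is $\ell\geqslant0$ such that for any $u\in V$, $(z_1-z_2)^\ell Y(z_1)(1\otimes Y(z_2))(\mathcal S(z_1-z_2)(v\otimes w)\otimes u)-(z_1-z_2)^\ell Y(z_2)(1\otimes Y(z_1))(w\otimes v\otimes u)\in h^nV[[z_1^{\pm1},z_2^{\pm1}]]$. The center of $V$ is $\mathfrak z(V)=\{v\in V\mid w_rv=0\text{ for all }w\in V\text{ and all }r\geqslant0\}$. It is closed under all $s$-products, $s\in\mathbb Z$, so the product in the claim is well-defined. *)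

(* Defs.v *)
From HB Require Import structures.
From mathcomp Require Import all_boot all_order all_algebra.
From mathcomp Require Import generic_quotient sesquilinear.
From mathcomp Require Import boolp classical_sets functions fsbigop.

Set Implicit Arguments.
Unset Strict Implicit.
Unset Printing Implicit Defensive.

Import Order.TTheory GRing.Theory Num.Theory.
Local Open Scope classical_set_scope.
Local Open Scope quotient_scope.
Local Open Scope ring_scope.

Section Tensor.
Variables (F : fieldType) (U V : lmodType F).

Definition tens_eval (W : nmodType) (f : U -> V -> W) (s : seq (U * V)) : W :=
  \sum_(p <- s) f p.1 p.2.

(* The list [s] stands for the sum of the u (x) v with (u, v) in [s]. Two such
   sums are equal in the tensor product iff no bilinear map to a vector space
   distinguishes them. *)
Definition tens_rel : rel (seq (U * V)) := fun s t =>
  `[< forall (W : lmodType F) (f : U -> V -> W),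
        bilinear_for *:%R *:%R f -> tens_eval f s = tens_eval f t >].

Lemma tens_rel_refl : reflexive tens_rel.
Proof. by move=> s; apply/asboolP. Qed.

Lemma tens_rel_sym : symmetric tens_rel.
Proof. by move=> s t; apply/asboolP/asboolP => h W f bf; rewrite h. Qed.

Lemma tens_rel_trans : transitive tens_rel.
Proof.
move=> t s r /asboolP h1 /asboolP h2; apply/asboolP => W f bf.
by rewrite h1 // h2.
Qed.

Canonical tens_equiv :=
  EquivRel tens_rel tens_rel_refl tens_rel_sym tens_rel_trans.

Definition tens := {eq_quot tens_rel}.
HB.instance Definition _ := Choice.on tens.
HB.instance Definition _ := EqQuotient.on tens.

Definition pure_tens (u : U) (v : V) : tens := \pi_tens [:: (u, v)].
Definition tens0 : tens := \pi_tens [::].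
Definition tens_add (s t : tens) : tens := \pi_tens (repr s ++ repr t).
Definition tens_scale (a : F) (s : tens) : tens :=
  \pi_tens [seq (a *: p.1, p.2) | p <- repr s].

(* The linear map on the tensor product induced by a bilinear map [f]
   (an arbitrary function when [f] is not bilinear). *)
Definition tens_lift (W : nmodType) (f : U -> V -> W) (t : tens) : W :=
  tens_eval f (repr t).

Lemma tens_lift_pi (W : lmodType F) (f : U -> V -> W) s :
  bilinear_for *:%R *:%R f -> tens_lift f (\pi_tens s) = tens_eval f s.
Proof.
move=> bf; have /eqmodP/asboolP : repr (\pi_tens s) = s %[mod tens].
  by rewrite reprK.
exact.
Qed.

Lemma tens_ext (s t : tens) :
  (forall (W : lmodType F) (f : U -> V -> W),
     bilinear_for *:%R *:%R f -> tens_lift f s = tens_lift f t) -> s = t.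
Proof.
by move=> h; rewrite -[s]reprK -[t]reprK; apply/eqmodP/asboolP.
Qed.

Section LiftOps.
Variables (W : lmodType F) (f : U -> V -> W).
Hypothesis bf : bilinear_for *:%R *:%R f.

Lemma tens_lift_add s t :
  tens_lift f (tens_add s t) = tens_lift f s + tens_lift f t.
Proof. by rewrite tens_lift_pi // /tens_eval big_cat. Qed.

Lemma tens_lift0 : tens_lift f tens0 = 0.
Proof. by rewrite tens_lift_pi // /tens_eval big_nil. Qed.

Lemma tens_lift_scale a s :
  tens_lift f (tens_scale a s) = a *: tens_lift f s.
Proof.
rewrite tens_lift_pi // /tens_lift /tens_eval big_map scaler_sumr.
apply: eq_bigr => p _ /=.
have := bf.1 p.2 a p.1 0; rewrite addr0 /= => ->.
have := bf.1 p.2 (-1) 0 0; rewrite scaler0 addr0 /= scaleN1r addNr => ->.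
by rewrite addr0.
Qed.

Lemma tens_lift_pure u v : tens_lift f (pure_tens u v) = f u v.
Proof. by rewrite tens_lift_pi // /tens_eval big_seq1. Qed.

End LiftOps.

Fact tens_addA : associative tens_add.
Proof. by move=> s t r; apply: tens_ext => W f bf; rewrite !tens_lift_add // addrA. Qed.
Fact tens_addC : commutative tens_add.
Proof. by move=> s t; apply: tens_ext => W f bf; rewrite !tens_lift_add // addrC. Qed.
Fact tens_add0 : left_id tens0 tens_add.
Proof.
by move=> s; apply: tens_ext => W f bf; rewrite tens_lift_add // tens_lift0 // add0r.
Qed.
Fact tens_addN : left_inverse tens0 (tens_scale (-1)) tens_add.
Proof.
move=> s; apply: tens_ext => W f bf.
by rewrite tens_lift_add // tens_lift_scale // tens_lift0 // scaleN1r addNr.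
Qed.

HB.instance Definition _ :=
  GRing.isZmodule.Build tens tens_addA tens_addC tens_add0 tens_addN.

Fact tens_scaleA a b s : tens_scale a (tens_scale b s) = tens_scale (a * b) s.
Proof. by apply: tens_ext => W f bf; rewrite !tens_lift_scale // scalerA. Qed.
Fact tens_scale1 : left_id 1 tens_scale.
Proof. by move=> s; apply: tens_ext => W f bf; rewrite tens_lift_scale // scale1r. Qed.
Fact tens_scaleDr : right_distributive tens_scale +%R.
Proof.
move=> a s t; apply: tens_ext => W f bf.
by rewrite tens_lift_add // !tens_lift_scale // tens_lift_add // scalerDr.
Qed.
Fact tens_scaleDl s : {morph tens_scale^~ s : a b / a + b}.
Proof.
move=> a b /=; apply: tens_ext => W f bf.
by rewrite tens_lift_add // !tens_lift_scale // scalerDl.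
Qed.

HB.instance Definition _ := GRing.Zmodule_isLmodule.Build F tens
  tens_scaleA tens_scale1 tens_scaleDr tens_scaleDl.

Lemma tens_lift_linear (W : lmodType F) (f : U -> V -> W) :
  bilinear_for *:%R *:%R f -> linear (tens_lift f).
Proof. by move=> bf a s t; rewrite tens_lift_add // tens_lift_scale. Qed.

Lemma pure_tens_bilinear : bilinear_for *:%R *:%R pure_tens.
Proof.
split=> [v|u] a x y; apply: tens_ext => W f bf; rewrite /= tens_lift_linear //.
  by rewrite !tens_lift_pure //; apply: (bf.1 v).
by rewrite !tens_lift_pure //; apply: (bf.2 u).
Qed.

Lemma tens_sum_pure (t : tens) : exists s, t = \sum_(p <- s) pure_tens p.1 p.2.
Proof.
exists (repr t); apply: tens_ext => W f bf; rewrite {1}/tens_lift /tens_eval.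
elim: (repr t) => [|p s IHs]; first by rewrite !big_nil [RHS](tens_lift0 bf).
by rewrite !big_cons [RHS](tens_lift_add bf) IHs tens_lift_pure.
Qed.

End Tensor.

Section Convolution.
Variable W : nmodType.

Lemma convA (T : nat -> nat -> nat -> W) n :
  \sum_(i < n.+1) \sum_(j < (n - i).+1) T i j (n - i - j)%N =
  \sum_(k < n.+1) \sum_(i < k.+1) T i (k - i)%N (n - k)%N.
Proof.
pose G (i k : nat) : W := T i (k - i)%N (n - k)%N.
transitivity (\sum_(i < n.+1) \sum_(k < n.+1 | (i <= k)%N) G i k).
  apply: eq_bigr => i _; have le_in : (i <= n)%N by rewrite -ltnS.
  rewrite -(big_mkord xpredT (fun j => T i j (n - i - j)%N)).
  rewrite -(big_mkord (fun k => (i <= k)%N) (G i)).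
  rewrite [RHS](big_cat_nat (n := i)) ?leqW //= [X in _ = X + _]big1_seq ?add0r; last first.
    move=> k; rewrite mem_index_iota => /andP[ik /andP[_ ki]].
    by rewrite leqNgt ki in ik.
  transitivity (\sum_(0 + i <= k < n.+1 | (i <= k)%N) G i k); last by rewrite add0n.
  rewrite big_addn subSn // [RHS]big_mkcond /=.
  apply: eq_bigr => j _; rewrite leq_addl /G addnK.
  by rewrite addnC subnDA.
rewrite (exchange_big_dep predT) //=; apply: eq_bigr => k _.
by rewrite (big_ord_narrow_leq (ltn_ord k : k <= n)%N).
Qed.

Lemma convC (T : nat -> nat -> W) n :
  \sum_(i < n.+1) T i (n - i)%N = \sum_(i < n.+1) T (n - i)%N i.
Proof.
rewrite (reindex_inj rev_ord_inj) /=; apply: eq_bigr => i _.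
by rewrite !subSS subKn // -ltnS.
Qed.

End Convolution.

Section PowerSeries.
Variable F : fieldType.

Definition fps := nat -> F.
HB.instance Definition _ := GRing.Zmodule.copy fps (nat -> F).

Definition fps_one : fps := fun n => (n == 0)%:R.
Definition fps_mul (a b : fps) : fps :=
  fun n => \sum_(i < n.+1) a i * b (n - i)%N.

Fact fps_mulA : associative fps_mul.
Proof.
move=> a b c; apply/funext => n; rewrite /fps_mul.
under eq_bigr do rewrite mulr_sumr.
rewrite (convA (fun i j k => a i * (b j * c k))).
apply: eq_bigr => k _; rewrite mulr_suml.
by apply: eq_bigr => i _; rewrite mulrA.
Qed.
Fact fps_mulC : commutative fps_mul.
Proof.
move=> a b; apply/funext => n; rewrite /fps_mul.
rewrite (convC (fun i j => a i * b j)).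
by apply: eq_bigr => i _; rewrite mulrC.
Qed.
Fact fps_mul1 : left_id fps_one fps_mul.
Proof.
move=> a; apply/funext => n; rewrite /fps_mul big_ord_recl mul1r subn0.
by rewrite big1 ?addr0 // => i _; rewrite mul0r.
Qed.
Fact fps_mulDl : left_distributive fps_mul +%R.
Proof.
move=> a b c; apply/funext => n.
rewrite [RHS]/GRing.add /= /fps_mul -big_split; apply: eq_bigr => i _ /=.
by rewrite -mulrDl.
Qed.
Fact fps_one_neq0 : fps_one != 0.
Proof. by apply/eqP => /(congr1 (fun a => a 0%N))/eqP; rewrite oner_eq0. Qed.

HB.instance Definition _ := GRing.Zmodule_isComNzRing.Build fps
  fps_mulA fps_mulC fps_mul1 fps_mulDl fps_one_neq0.

Definition fps_h : fps := fun n => (n == 1)%:R.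

End PowerSeries.

(* [topfree V0] is V0[[h]], the topologically free F[[h]]-module on [V0]. *)
Section TopFree.
Variables (F : fieldType) (V0 : lmodType F).

Definition topfree := nat -> V0.
HB.instance Definition _ := GRing.Zmodule.copy topfree (nat -> V0).

Definition topfree_scale (a : fps F) (v : topfree) : topfree :=
  fun n => \sum_(i < n.+1) a i *: v (n - i)%N.

Fact topfree_scaleA a b v :
  topfree_scale a (topfree_scale b v) = topfree_scale (a * b) v.
Proof.
apply/funext => n; rewrite /topfree_scale.
under eq_bigr do rewrite scaler_sumr.
rewrite (convA (fun i j k => a i *: (b j *: v k))).
apply: eq_bigr => k _; rewrite scaler_suml.
by apply: eq_bigr => i _; rewrite scalerA.
Qed.
Fact topfree_scale1 : left_id 1 topfree_scale.
Proof.
move=> v; apply/funext => n; rewrite /topfree_scale big_ord_recl scale1r subn0.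
by rewrite big1 ?addr0 // => i _; rewrite scale0r.
Qed.
Fact topfree_scaleDr : right_distributive topfree_scale +%R.
Proof.
move=> a v w; apply/funext => n.
rewrite [RHS]/GRing.add /= /topfree_scale -big_split; apply: eq_bigr => i _ /=.
by rewrite -scalerDr.
Qed.
Fact topfree_scaleDl v : {morph topfree_scale^~ v : a b / a + b}.
Proof.
move=> a b; apply/funext => n.
rewrite [RHS]/GRing.add /= /topfree_scale -big_split; apply: eq_bigr => i _ /=.
by rewrite -scalerDl.
Qed.

HB.instance Definition _ := GRing.Zmodule_isLmodule.Build (fps F) topfree
  topfree_scaleA topfree_scale1 topfree_scaleDr topfree_scaleDl.

Definition hconst (x : V0) : topfree := fun n => if n == 0%N then x else 0.

Definition in_hpow (n : nat) (v : topfree) : Prop :=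
  exists w : topfree, v = fps_h F ^+ n *: w.

(* The h-adically convergent sum of a family [f]: in every degree in h, only
   finitely many members of a convergent family are nonzero (otherwise that
   degree of the sum is set to 0). *)
Definition hsum (I : choiceType) (f : I -> topfree) : topfree :=
  fun n => \sum_(i \in [set: I]) f i n.

End TopFree.

(* The coefficientwise extension of a linear map of vector spaces *)
Definition hmap (F : fieldType) (U0 W0 : lmodType F) (f : U0 -> W0)
  (u : topfree U0) : topfree W0 := fun n => f (u n).

(* The completed tensor product of U0[[h]] and V0[[h]] over F[[h]] is
   (U0 (x) V0)[[h]], i.e. [topfree (tens U0 V0)]. *)
Section CompletedTensor.
Variable F : fieldType.

Definition htens (U0 V0 : lmodType F) (u : topfree U0) (v : topfree V0) :
    topfree (tens U0 V0) :=
  fun n => \sum_(i < n.+1) pure_tens (u i) (v (n - i)%N).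

(* The F[[h]]-linear map on the completed tensor product induced by an
   F[[h]]-bilinear map [f]. *)
Definition hlift (U0 V0 W0 : lmodType F)
    (f : topfree U0 -> topfree V0 -> topfree W0) (t : topfree (tens U0 V0)) :
    topfree W0 :=
  fun n => \sum_(i < n.+1)
    tens_lift (fun x y => f (hconst x) (hconst y) (n - i)%N) (t i).

(* f (x) g for F[[h]]-linear maps f and g *)
Definition htmap (U0 V0 U1 V1 : lmodType F)
    (f : topfree U0 -> topfree U1) (g : topfree V0 -> topfree V1) :
    topfree (tens U0 V0) -> topfree (tens U1 V1) :=
  hlift (fun u v => htens (f u) (g v)).

Lemma htens_linearr (U0 V0 : lmodType F) (u : topfree U0) :
  linear (htens u : topfree V0 -> _).
Proof.
have ladd x (y y' : V0) :
    pure_tens x (y + y') = pure_tens x y + pure_tens x y' :> tens U0 V0.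
  by have := (pure_tens_bilinear U0 V0).2 x 1 y y'; rewrite /= !scale1r.
have l0 x : pure_tens x 0 = 0 :> tens U0 V0.
  by apply: (addIr (pure_tens x 0)); rewrite -ladd !add0r.
have lscale x a (y : V0) : pure_tens x (a *: y) = a *: pure_tens x y :> tens U0 V0.
  by have := (pure_tens_bilinear U0 V0).2 x a y 0; rewrite /= l0 !addr0.
have lsum x n (y : 'I_n -> V0) : pure_tens x (\sum_i y i) =
    \sum_i pure_tens x (y i) :> tens U0 V0.
  by apply: (big_morph (pure_tens x)) => [y1 y2|]; rewrite ?ladd ?l0.
move=> a v w; apply/funext => n; rewrite [RHS]/GRing.add /= /htens.
transitivity (\sum_(i < n.+1) (pure_tens (u i) ((a *: v) (n - i)%N)
    + pure_tens (u i) (w (n - i)%N)) : tens U0 V0).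
  by apply: eq_bigr => i _; rewrite -ladd.
rewrite big_split; congr (_ + _).
transitivity (\sum_(i < n.+1) \sum_(j < (n - i).+1)
    a j *: pure_tens (u i) (v (n - i - j)%N) : tens U0 V0).
  by apply: eq_bigr => i _; rewrite lsum; apply: eq_bigr => j _; rewrite lscale.
rewrite (convA (fun i j k => a j *: pure_tens (u i) (v k))).
transitivity (\sum_(i < n.+1) \sum_(j < (n - i).+1)
    a i *: pure_tens (u j) (v (n - i - j)%N) : tens U0 V0).
  rewrite (convA (fun i j k => a i *: pure_tens (u j) (v k))).
  apply: eq_bigr => k _.
  by rewrite (convC (fun i j => a j *: pure_tens (u i) (v (n - k)%N))).
by apply: eq_bigr => i _; rewrite scaler_sumr.
Qed.

Definition tswap (U0 V0 : lmodType F) : tens U0 V0 -> tens V0 U0 :=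
  tens_lift (fun x y => pure_tens y x).

Definition tassoc (U0 V0 W0 : lmodType F) :
    tens (tens U0 V0) W0 -> tens U0 (tens V0 W0) :=
  tens_lift (fun t z => tens_lift (fun x y => pure_tens x (pure_tens y z)) t).

(* (x (x) y) (x) z |-> (x (x) z) (x) y *)
Definition tperm23 (U0 V0 W0 : lmodType F) :
    tens (tens U0 V0) W0 -> tens (tens U0 W0) V0 :=
  tens_lift (fun t z => tens_lift (fun x y => pure_tens (pure_tens x z) y) t).

(* (x (x) y) (x) z |-> (y (x) z) (x) x, and its inverse *)
Definition trot (U0 V0 W0 : lmodType F) :
    tens (tens U0 V0) W0 -> tens (tens V0 W0) U0 :=
  fun t => tswap (tassoc t).

Definition trotV (U0 V0 W0 : lmodType F) :
    tens (tens V0 W0) U0 -> tens (tens U0 V0) W0 :=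
  fun t => trot (trot t).

(* the operators T_21 on V (x) V and T_12, T_13, T_23 on V (x) V (x) V *)
Section Legs.
Variable V0 : lmodType F.
Variable T : topfree (tens V0 V0) -> topfree (tens V0 V0).

Definition leg21 (t : topfree (tens V0 V0)) : topfree (tens V0 V0) :=
  hmap (@tswap V0 V0) (T (hmap (@tswap V0 V0) t)).

Definition leg12 : topfree (tens (tens V0 V0) V0) ->
    topfree (tens (tens V0 V0) V0) := htmap T id.

Definition leg13 (t : topfree (tens (tens V0 V0) V0)) :
    topfree (tens (tens V0 V0) V0) :=
  hmap (@tperm23 V0 V0 V0) (leg12 (hmap (@tperm23 V0 V0 V0) t)).

Definition leg23 (t : topfree (tens (tens V0 V0) V0)) :
    topfree (tens (tens V0 V0) V0) :=
  hmap (@trotV V0 V0 V0) (leg12 (hmap (@trot V0 V0 V0) t)).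

End Legs.

End CompletedTensor.

(* F((z)): the value at [k] is the coefficient of z^k. *)
Section Laurent.
Variable F : fieldType.

Definition is_laurent (f : int -> F^o) : bool :=
  `[< exists N : int, forall k : int, k < N -> f k = 0 >].

Fact is_laurent_submod : submod_closed is_laurent.
Proof.
split; first by apply/asboolP; exists 0.
move=> a f g /asboolP[M fM] /asboolP[N gN]; apply/asboolP.
exists (Num.min M N) => k; rewrite lt_min => /andP[kM kN].
have -> : (a *: f + g) k = a *: f k + g k by [].
by rewrite fM // gN // scaler0 addr0.
Qed.
HB.instance Definition _ :=
  GRing.isSubmodClosed.Build F (int -> F^o) is_laurent is_laurent_submod.

Record laurent := Laurent { lcoef :> int -> F^o; _ : lcoef \in is_laurent }.
HB.instance Definition _ := [isSub for lcoef].
HB.instance Definition _ := [Choice of laurent by <:].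
HB.instance Definition _ := [SubChoice_isSubLmodule of laurent by <:].

Fact is_laurent_deriv (f : laurent) :
  (fun k => (k + 1)%:~R * f (k + 1)) \in is_laurent.
Proof.
case: f => f /= /asboolP[N fN]; apply/asboolP; exists (N - 1) => k kN.
by rewrite fN ?mulr0 // -ltrBrDr.
Qed.
Definition lderiv (f : laurent) : laurent := Laurent (is_laurent_deriv f).

End Laurent.

(* V_h((z)) for V = V0[[h]]: the value at [k] is the coefficient of z^k, so
   that k = - r - 1 for the coefficient written v_r. *)
Section HLaurent.
Variables (F : fieldType) (V0 : lmodType F).

Definition is_hlaurent (f : int -> topfree V0) : bool :=
  `[< forall n : nat, exists N : int, forall k : int,
        k < N -> in_hpow n (f k) >].

Fact is_hlaurent_submod : submod_closed is_hlaurent.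
Proof.
split; first by apply/asboolP=> n; exists 0 => k _; exists 0; rewrite scaler0.
move=> a f g /asboolP hf /asboolP hg; apply/asboolP => n.
have [M fM] := hf n; have [N gN] := hg n.
exists (Num.min M N) => k; rewrite lt_min => /andP[/fM[x fx] /gN[y gy]].
exists (a *: x + y); have -> : (a *: f + g) k = a *: f k + g k by [].
by rewrite fx gy scalerDr !scalerA mulrC.
Qed.
HB.instance Definition _ := GRing.isSubmodClosed.Build
  (fps F) (int -> topfree V0) is_hlaurent is_hlaurent_submod.

Record hlaurent :=
  HLaurent { hcoef :> int -> topfree V0; _ : hcoef \in is_hlaurent }.
HB.instance Definition _ := [isSub for hcoef].
HB.instance Definition _ := [Choice of hlaurent by <:].
HB.instance Definition _ := [SubChoice_isSubLmodule of hlaurent by <:].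

End HLaurent.

(* the binomial coefficient k (k - 1) ... (k - j + 1) / j! for an integer k *)
Definition binz (k : int) (j : nat) : int :=
  match k with
  | Posz n => 'C(n, j)%:Z
  | Negz n => (-1) ^+ j * 'C(n + j, j)%:Z
  end.

Section TwoVariables.
Variables (F : fieldType) (V0 : lmodType F).

(* V[[z1^{+-1}, z2^{+-1}]]: [f a b] is the coefficient of z1^a z2^b. *)
Definition series2 := int -> int -> topfree V0.

(* If [G k] is the coefficient of z^k in a series in z, z1 and z2, this is the
   result of the substitution z = z1 + e z2 (e = 1 or -1), with the powers
   (z1 + e z2)^k expanded in nonnegative powers of z2. *)
Definition zsubst (e : int) (G : int -> series2) : series2 := fun a b =>
  hsum (fun p : int * nat =>
    G p.1 (a - (p.1 - p.2%:Z)) (b - p.2%:Z) *~ (e ^+ p.2 * binz p.1 p.2)).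

(* (z1 + e z2)^l f *)
Definition zbinom_mul (e : int) (l : nat) (f : series2) : series2 :=
  zsubst e (fun k => if k == l%:Z then f else fun _ _ => 0).

(* f - g has all its coefficients in h^n V *)
Definition series2_eqmod (n : nat) (f g : series2) : Prop :=
  forall a b, in_hpow n (f a b - g a b).

End TwoVariables.

Section VertexOperators.
Variables (F : fieldType) (V0 : lmodType F).
Local Notation V := (topfree V0).
Local Notation VV := (topfree (tens V0 V0)).
Local Notation VVV := (topfree (tens (tens V0 V0) V0)).

Section StateField.
Variable Y : VV -> hlaurent V0.

(* Y(z1) (1 (x) Y(z2)) t, where the exponent [a] is that of z1, the variable
   of the outer factor *)
Definition Ynest (t : VVV) : series2 V0 := fun a b =>
  Y (htmap id (fun s => Y s b) (hmap (@tassoc F V0 V0 V0) t)) a.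

(* coefficient of z0^a z2^b in Y(v, z0 + z2) Y(w, z2) u *)
Definition Ycomp_shift (v w u : V) : series2 V0 :=
  zsubst 1 (fun k a b => if a == 0 then Y (htens v (Y (htens w u) b)) k else 0).

(* coefficient of z0^a z2^b in Y(Y(v, z0) w, z2) u *)
Definition Yiter (v w u : V) : series2 V0 :=
  fun a b => Y (htens (Y (htens v w) a) u) b.

Definition weak_associativity : Prop := forall (u v w : V) (n : nat),
  exists l : nat, series2_eqmod n
    (zbinom_mul 1 l (Ycomp_shift v w u)) (zbinom_mul 1 l (Yiter v w u)).

End StateField.

Section Braiding.
Variable S : VV -> topfree (tens (tens V0 V0) (laurent F)).

(* the coefficient of z^k in S(z) *)
Definition Scoef (k : int) (t : VV) : VV :=
  hmap (tens_lift (fun x (f : laurent F) => (f k : F) *: x)) (S t).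

Definition shift_condition (D : V -> V) : Prop := forall t : VV,
  htmap (htmap D id) id (S t) - S (htmap D id t) =
  - hmap (tens_lift (fun x f => pure_tens x (lderiv f))) (S t).

(* S_12(z1) S_13(z1 + z2) S_23(z2) = S_23(z2) S_13(z1 + z2) S_12(z1),
   compared at z1^a z2^b *)
Definition yang_baxter : Prop := forall (t : VVV) (a b : int),
  zsubst 1 (fun l a b =>
    leg12 (Scoef a) (leg13 (Scoef l) (leg23 (Scoef b) t))) a b =
  zsubst 1 (fun l a b =>
    leg23 (Scoef b) (leg13 (Scoef l) (leg12 (Scoef a) t))) a b.

(* S_21(z) and S(-z) are inverse to each other; the sums give the coefficient
   of z^k in the two composites. *)
Definition unitarity : Prop := forall (t : VV) (k : int),
  hsum (fun l : int =>
    leg21 (Scoef (k - l)) (Scoef l t) *~ (-1) ^+ `|l|%N) =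
    (if k == 0 then t else 0) /\
  hsum (fun l : int =>
    Scoef l (leg21 (Scoef (k - l)) t) *~ (-1) ^+ `|l|%N) =
    (if k == 0 then t else 0).

Definition S_locality (Y : VV -> hlaurent V0) : Prop :=
  forall (v w : V) (n : nat), exists l : nat, forall u : V,
  series2_eqmod n
    (zbinom_mul (-1) l
      (zsubst (-1) (fun k => Ynest Y (htens (Scoef k (htens v w)) u))))
    (zbinom_mul (-1) l
      (fun a b => Ynest Y (htens (htens w v) u) b a)).

End Braiding.

Record quantum_vertex_algebra := QuantumVertexAlgebra {
  qva_Y : {linear VV -> hlaurent V0};
  qva_vac : V;
  qva_D : {linear V -> V};
  qva_S : {linear VV -> topfree (tens (tens V0 V0) (laurent F))};
  _ : weak_associativity qva_Y;
  _ : forall (v : V) (k : int),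
        qva_Y (htens qva_vac v) k = if k == 0 then v else 0;
  _ : forall (v : V) (k : int),
        k < 0 -> qva_Y (htens v qva_vac) k = 0;
  _ : forall v : V, qva_Y (htens v qva_vac) 0 = v;
  _ : qva_D qva_vac = 0;
  _ : forall (v w : V) (k : int),
        qva_Y (htens v w) (k + 1) *~ (k + 1) =
        qva_D (qva_Y (htens v w) k) - qva_Y (htens v (qva_D w)) k;
  _ : shift_condition qva_S qva_D;
  _ : yang_baxter qva_S;
  _ : unitarity qva_S;
  _ : S_locality qva_S qva_Y
}.

End VertexOperators.

Section Center.
Variables (F : fieldType) (V0 : lmodType F) (Q : quantum_vertex_algebra V0).

Definition rprod (r : int) (v w : topfree V0) : topfree V0 :=
  qva_Y Q (htens v w) (- r - 1).

Definition in_center (v : topfree V0) : bool :=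
  `[< forall (w : topfree V0) (r : int), 0 <= r -> rprod r w v = 0 >].

Fact in_center_submod : submod_closed in_center.
Proof.
have lin w r : linear (rprod r w).
  by move=> a u v; rewrite /rprod htens_linearr linearP.
split.
  apply/asboolP => w r _.
  by have := lin w r (-1) 0 0; rewrite scaler0 addr0 scaleN1r addNr.
move=> a u v /asboolP hu /asboolP hv; apply/asboolP => w r r0.
by rewrite lin hu // hv // scaler0 addr0.
Qed.
HB.instance Definition _ := GRing.isSubmodClosed.Build
  (fps F) (topfree V0) in_center in_center_submod.

Record center := Center { center_val :> topfree V0; _ : center_val \in in_center }.
HB.instance Definition _ := [isSub for center_val].
HB.instance Definition _ := [Choice of center by <:].
HB.instance Definition _ := [SubChoice_isSubLmodule of center by <:].

End Center.

Section Algebra.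
Variables (K : comNzRingType) (A : lmodType K).

Definition unital_associative (mul : A -> A -> A) : Prop :=
  [/\ bilinear_for *:%R *:%R mul, associative mul
    & exists one : A, left_id one mul /\ right_id one mul].

Definition derivation (mul : A -> A -> A) (d : A -> A) : Prop :=
  linear d /\ forall x y, d (mul x y) = mul (d x) y + mul x (d y).

End Algebra.

(* Main.v *)
Require Import Defs.
From HB Require Import structures.
From mathcomp Require Import all_boot all_order all_algebra.
From mathcomp Require Import reals complex.
From mathcomp Require Import sesquilinear boolp classical_sets functions fsbigop.

(* If [w] and [u] are central, then Y(Y(v, z0) w, z2) u is a Taylor series in z0
   and z2. As Y(v, z0 + z2) Y(w, z2) u has no negative powers of z2, the factor
   (z0 + z2)^l can be cancelled in weak associativity modulo every h^n, so the
   two series are equal. Reading Y(v, z) Y(w, z2) u off this Taylor series shows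
   that all products w_s u are central; the constant terms give associativity,
   and the coefficient of z0 for [w] the vacuum gives (D v)_{-1} u = v_{-2} u,
   from which the Leibniz rule follows. *)

Set Implicit Arguments.
Unset Strict Implicit.
Import Order.TTheory GRing.Theory Num.Theory.
Local Open Scope ring_scope.

Lemma binz0 k : binz k 0 = 1.
Proof. by case: k => n; rewrite /= bin0. Qed.

(** * Degrees in h, finite sums and cancellation of (z1 + z2)^l *)

Section TopologicallyFree.
Variables (F : fieldType) (V0 : lmodType F).

Lemma topfree_sumE (I : Type) (r : seq I) (f : I -> topfree V0) n :
  (\sum_(i <- r) f i) n = \sum_(i <- r) f i n.
Proof. by apply: (big_morph (fun v : topfree V0 => v n)). Qed.

Lemma topfree_mulzE (v : topfree V0) (k : int) n : (v *~ k) n = v n *~ k.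
Proof.
have mulnE m : (v *+ m) n = v n *+ m.
  by elim: m => // m IHm; rewrite !mulrSr -IHm.
by case: k => m; rewrite ?NegzE ?mulrNz -?pmulrn -mulnE.
Qed.

(** Each factor h shifts degrees by one. This turns congruences modulo h^n into equalities of
    coefficients in degrees below n. *)
Lemma in_hpow_lt n (v : topfree V0) m : in_hpow n v -> (m < n)%N -> v m = 0.
Proof.
case=> w ->; elim: n m => // n IHn m.
rewrite exprS -scalerA => mn.
transitivity (\sum_(i < m.+1)
    fps_h F i *: ((fps_h F ^+ n *: w) : topfree V0) (m - i)%N); first by [].
apply: big1 => i _; rewrite /fps_h; case: eqP => [i1|_]; last by rewrite scale0r.
have m_gt0 : (0 < m)%N by have := ltn_ord i; rewrite i1 ltnS.
by rewrite i1 scale1r IHn // subn1 prednK // -ltnS.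
Qed.

(** Both [zbinom_mul] and, on a central vector, [Ycomp_shift] have finitely many nonzero terms; this
    makes them ordinary sums, so the default value in [hsum] never enters. *)
Lemma hsum_fin (I : choiceType) (f : I -> topfree V0) n (g : 'I_n -> I) :
  injective g -> (forall i, i \notin codom g -> f i = 0) ->
  hsum f = \sum_(j < n) f (g j).
Proof.
move=> g_inj f0; apply/funext => m; rewrite topfree_sumE /hsum.
rewrite (@fsbigE _ _ _ _ _ (codom g)).
- by rewrite (eq_bigl xpredT) ?big_image // => i; apply/mem_set.
- by rewrite map_inj_uniq ?enum_uniq.
- by [].
- by move=> i _ /f0->.
Qed.

Lemma zbinom_mulE e l (f : series2 V0) a b :
  zbinom_mul e l f a b =
  \sum_(j < l.+1) f (a - (l%:Z - j%:Z)) (b - j%:Z) *~ (e ^+ j * 'C(l, j)%:Z).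
Proof.
rewrite /zbinom_mul /zsubst.
rewrite (@hsum_fin _ _ l.+1 (fun j : 'I_l.+1 => (l%:Z, j : nat))).
- by apply: eq_bigr => j _ /=; rewrite eqxx.
- by move=> i j [] /val_inj.
move=> [k j] /=; case: eqP => [->|_ _]; last by rewrite mul0rz.
have [jl|lj _] := ltnP j l.+1; last by rewrite /= bin_small // mulr0 mulr0z.
by rewrite (codom_f (fun j : 'I_l.+1 => (l%:Z, j : nat)) (Ordinal jl)).
Qed.

(* Induction on the power of z2, as z1^l has coefficient 1 in (z1 + z2)^l. *)
Lemma zbinom_mul_cancel n l (f g : series2 V0) a b m :
  (forall a b, b < 0 -> f a b = g a b) ->
  series2_eqmod n (zbinom_mul 1 l f) (zbinom_mul 1 l g) ->
  (m < n)%N -> f a b m = g a b m.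
Proof.
move=> fg0 fg mn; case: b => b; last by rewrite fg0.
elim/ltn_ind: b a => b IHb a.
(* At exponent a + l of z1, the term of index 0 is the coefficient at (a, b); the other terms have
   smaller powers of z2. *)
have : zbinom_mul 1 l f (a + l%:Z) b%:Z m = zbinom_mul 1 l g (a + l%:Z) b%:Z m.
  by apply: subr0_eq; apply: in_hpow_lt (fg _ _) mn.
rewrite !zbinom_mulE !topfree_sumE.
rewrite !big_ord_recl /= !topfree_mulzE bin0 expr0 mulr1 !mulr1z !subr0 addrK.
set s := \sum_(i < l) _; set t := \sum_(i < l) _.
suff -> : s = t by move/addIr.
apply: eq_bigr => i _; rewrite !topfree_mulzE; congr (_ *~ _).
have [bi|ib] := ltnP b (lift ord0 i); first by rewrite fg0 // subr_lt0.
by rewrite [b%:Z - _]subzn // IHb // ltn_subrL /= (leq_trans _ ib).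
Qed.

End TopologicallyFree.

(** * Bilinearity of the completed tensor product *)

Section Tensor.
Variables (F : fieldType) (U0 V0 : lmodType F).

Lemma hmap_linear (f : {linear U0 -> V0}) : linear (hmap f).
Proof.
move=> a u v; apply/funext => n.
transitivity (f (\sum_(i < n.+1) a i *: u (n - i)%N + v n)); first by [].
rewrite linearD linear_sum; congr (_ + _).
by apply: eq_bigr => i _; rewrite linearZ.
Qed.

Lemma pure_tens_flip_bilinear :
  bilinear_for *:%R *:%R (fun (x : U0) (y : V0) => pure_tens y x).
Proof.
by split=> [y|x] a u v; [apply: (pure_tens_bilinear V0 U0).2
                        |apply: (pure_tens_bilinear V0 U0).1].
Qed.

HB.instance Definition _ := GRing.isLinear.Build F (tens U0 V0) (tens V0 U0)
  *:%R (@tswap F U0 V0) (tens_lift_linear pure_tens_flip_bilinear).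

Lemma hmap_tswap_htens (u : topfree U0) (v : topfree V0) :
  hmap (@tswap F U0 V0) (htens u v) = htens v u.
Proof.
apply/funext => n; rewrite /hmap /htens linear_sum /=.
rewrite [RHS](convC (fun i j => pure_tens (v i) (u j))).
by apply: eq_bigr => i _; apply: tens_lift_pure pure_tens_flip_bilinear _ _.
Qed.

End Tensor.

(** The swap of the factors transports linearity from the right factor. *)
Lemma htens_linearl (F : fieldType) (U0 V0 : lmodType F) (v : topfree V0) :
  linear (fun u : topfree U0 => htens u v).
Proof.
by move=> a x y; rewrite -!(@hmap_tswap_htens _ V0) htens_linearr hmap_linear.
Qed.

(** * Products and translation on the center *)

Section Center.
Variables (F : fieldType) (V0 : lmodType F) (Q : quantum_vertex_algebra V0).
Local Notation Y := (qva_Y Q).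
Implicit Types v w u : topfree V0.

(** The r-product is the coefficient of z^k with k = - r - 1, so u is central iff every Y(v, z) u is
    a Taylor series. *)
Lemma in_centerP u :
  u \in in_center Q <-> forall v (k : int), k < 0 -> Y (htens v u) k = 0.
Proof.
split=> [/asboolP cu v k k0|cu].
  have := cu v (- k - 1); rewrite /rprod opprB opprK addrAC subrr add0r; apply.
  rewrite -oppr_gt0 in k0; by rewrite subr_ge0 -gtz0_ge1.
apply/asboolP => v r r0; apply: cu.
by rewrite -opprD oppr_lt0 ltr_wpDl.
Qed.

Lemma rprodN1 v w : rprod Q (-1) v w = Y (htens v w) 0.
Proof. by rewrite /rprod opprK subrr. Qed.

Lemma Yr_linear v k : linear (fun u => Y (htens v u) k).
Proof. by move=> a x y; rewrite htens_linearr linearP. Qed.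

Lemma Yl_linear u k : linear (fun v => Y (htens v u) k).
Proof. by move=> a x y; rewrite htens_linearl linearP. Qed.

Lemma Y_0r v k : Y (htens v 0) k = 0.
Proof.
by have := Yr_linear v k (-1) 0 0; rewrite scaler0 addr0 scaleN1r addNr.
Qed.

Lemma Y_0l u k : Y (htens 0 u) k = 0.
Proof.
by have := Yl_linear u k (-1) 0 0; rewrite scaler0 addr0 scaleN1r addNr.
Qed.

(** Taking z0^a z2^j from (z0 + z2)^k forces k = a + j, and centrality of [u] leaves only j <= b.
    Any [n] beyond [b] bounds the sum; n = 0 serves for negative [b]. *)
Lemma Ycomp_shift_center v w u a b n :
  u \in in_center Q -> b < n%:Z ->
  Ycomp_shift Y v w u a b =
  \sum_(j < n) Y (htens v (Y (htens w u) (b - j%:Z))) (a + j%:Z)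
                 *~ binz (a + j%:Z) j.
Proof.
move=> /in_centerP cu bn; pose g (j : 'I_n) : int * nat := (a + j%:Z, j : nat).
rewrite /Ycomp_shift /zsubst (@hsum_fin _ _ _ _ n g).
- by apply: eq_bigr => j _ /=; rewrite addrK subrr eqxx expr1n mul1r.
- by move=> i j [] _ /val_inj.
move=> [k j] /=; rewrite subr_eq0 expr1n mul1r.
case: eqP => [ak|_ _]; last by rewrite mul0rz.
have [jn|nj _] := ltnP j n; last first.
  by rewrite cu ?Y_0r ?mul0rz // subr_lt0 (lt_le_trans bn).
by case/negP; have := codom_f g (Ordinal jn); rewrite /g /= ak subrK.
Qed.

Lemma Y_assoc_center v w u a b n :
  w \in in_center Q -> u \in in_center Q -> b < n%:Z ->
  \sum_(j < n) Y (htens v (Y (htens w u) (b - j%:Z))) (a + j%:Z)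
                 *~ binz (a + j%:Z) j =
  Y (htens (Y (htens v w) a) u) b.
Proof.
move=> cw cu bn; rewrite -(Ycomp_shift_center _ _ _ cu bn).
apply/funext => m.
have wa : weak_associativity Y by case: Q.
(* Degree [m] in h is seen modulo h^(m+1). *)
have [l wl] := wa u v w m.+1.
apply: (@zbinom_mul_cancel _ _ m.+1 l _ (Yiter Y v w u)) => // a' b' b0.
(* At negative powers of z2 both series vanish, as [u] is central. *)
rewrite (Ycomp_shift_center _ _ _ (n := 0)) // big_ord0.
by rewrite /Yiter ((in_centerP u).1 cu).
Qed.

(* When [a < 0] the right-hand side of [Y_assoc_center] vanishes, and so do the
   terms with [j > 0] on the left: by induction if [a + j < 0], and because
   [binz (a + j) j = 0] if [0 <= a + j < j]. *)
Lemma Y_center w u k :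
  w \in in_center Q -> u \in in_center Q -> Y (htens w u) k \in in_center Q.
Proof.
move=> cw cu; case: k => [k|k]; last first.
  by rewrite ((in_centerP u).1 cu) // rpred0.
apply/in_centerP => v; elim/ltn_ind: k => k IHk a a0.
(* At b = k the term j = 0 is the coefficient to be shown zero. *)
have := @Y_assoc_center v w u a k%:Z k.+1 cw cu (ltnSn k).
rewrite ((in_centerP w).1 cw) // Y_0l big_ord_recl /= subr0 addr0.
rewrite binz0 mulr1z big1 ?addr0 // => j _.
case aj: (a + (bump 0 j)%:Z) => [p|p]; last first.
  by rewrite subzn ?IHk ?mul0rz // /bump ltn_subrL (leq_ltn_trans _ (ltn_ord j)).
rewrite /= bin_small ?mulr0z // -ltz_nat -aj.
by rewrite -subr_gt0 opprD addrC subrK oppr_gt0.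
Qed.

Lemma vac_center : qva_vac Q \in in_center Q.
Proof. by apply/in_centerP; case: Q. Qed.

Lemma Y_vacl v k : Y (htens (qva_vac Q) v) k = if k == 0 then v else 0.
Proof. by case: Q. Qed.

Lemma Y_vacr v : Y (htens v (qva_vac Q)) 0 = v.
Proof. by case: Q. Qed.

Lemma D_vac : qva_D Q (qva_vac Q) = 0.
Proof. by case: Q. Qed.

Lemma Y_deriv v w k :
  Y (htens v w) (k + 1) *~ (k + 1) =
  qva_D Q (Y (htens v w) k) - Y (htens v (qva_D Q w)) k.
Proof. by case: Q. Qed.

Lemma D_center u : u \in in_center Q -> qva_D Q u \in in_center Q.
Proof.
move=> /in_centerP cu; apply/in_centerP => v k k0.
have := Y_deriv v u k; rewrite (cu v k) // linear0 sub0r => /esym/eqP.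
rewrite eqr_oppLR => /eqP ->.
(* At k = -1 the factor k + 1 vanishes; below it, the coefficient of z^(k+1) does. *)
have := k0; rewrite -lezD1 le_eqVlt => /predU1P[->|k1].
  by rewrite mulr0z oppr0.
by rewrite cu // mul0rz oppr0.
Qed.

Lemma Y_DlE v u : u \in in_center Q ->
  Y (htens (qva_D Q v) u) 0 = Y (htens v u) 1.
Proof.
move=> cu; have := @Y_assoc_center v _ u 1 0 1 vac_center cu isT.
rewrite big_ord1 subr0 addr0 binz0 mulr1z Y_vacl eqxx.
move=> ->; congr (Y (htens _ u) 0).
(* The coefficient of z in Y(v, z) applied to the vacuum is D v. *)
by have := Y_deriv v (qva_vac Q) 0; rewrite add0r D_vac Y_0r Y_vacr subr0.
Qed.

Lemma Y0_assoc v w u : w \in in_center Q -> u \in in_center Q ->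
  Y (htens v (Y (htens w u) 0)) 0 = Y (htens (Y (htens v w) 0) u) 0.
Proof.
move=> cw cu; rewrite -(@Y_assoc_center v w u 0 0 1) //.
by rewrite big_ord1 subr0 binz0 mulr1z.
Qed.

(** The translation axiom at z^0 expresses v_{-2} u, which is (D v)_{-1} u by [Y_DlE]. *)
Lemma D_Y0 v u : u \in in_center Q ->
  qva_D Q (Y (htens v u) 0) =
  Y (htens (qva_D Q v) u) 0 + Y (htens v (qva_D Q u)) 0.
Proof.
move=> cu; rewrite Y_DlE //.
by have := Y_deriv v u 0; rewrite add0r mulr1z => ->; rewrite subrK.
Qed.

End Center.

Theorem proposition3p7 (R : realType) (V0 : lmodType R[i])
    (Q : quantum_vertex_algebra V0) :
  exists mul : center Q -> center Q -> center Q,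
    [/\ forall w u : center Q,
          center_val (mul w u) = rprod Q (-1) (center_val w) (center_val u),
        unital_associative mul
      & exists d : center Q -> center Q,
          (forall w : center Q, center_val (d w) = qva_D Q (center_val w)) /\
          derivation mul d].
Proof.
have cP (x : center Q) : val x \in in_center Q := valP x.
(* The (-1)-product is the coefficient of z^0. *)
pose mul w u : center Q := Center (Y_center 0 (cP w) (cP u)).
pose d w : center Q := Center (D_center (cP w)).
exists mul; split; first by move=> w u; rewrite rprodN1.
  split.
  - split=> [u|w] a x y; apply: val_inj; rewrite linearP /=.
      exact: Yl_linear.
    exact: Yr_linear.
  - by move=> w u x; apply: val_inj; apply: Y0_assoc.
  exists (Center (vac_center Q)); split=> w; apply: val_inj => /=.
    by rewrite Y_vacl eqxx.
  exact: Y_vacr.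
exists d; split=> //; split=> [a x y|x y]; apply: val_inj.
  by rewrite linearP /= linearP.
by rewrite raddfD /=; apply: D_Y0; apply: cP.
Qed.
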